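(* Let $(G,\rho,V)$ be a prehomogeneous vector space with basic relative invariants $f_1,\ldots,f_r$, and let $\chi_i$ be the character of $G$ corresponding to $f_i$. Let $h=\frac{h_1}{f}$ for homogeneous polynomials $h_1$ and $f$ on $V$ with $\deg(h_1)=\deg(f)$, $h$ written in lowest terms, and $f=f_1^{k_1}\cdots f_r^{k_r}$ with $k_i\geq 0$. Let $\chi=\chi_1^{k_1}\cdots\chi_r^{k_r}$. Then the following are equivalent: (1) $h$ is an additive relative invariant. (2) For all $i=1,\ldots,r$ with $k_i>0$, and all $g\in G$, $h_1\circ\rho(g)$ and $\chi(g)\cdot h_1$ agree to order $k_i-1$ on $V(f_i)$. (3) For all $g\in G$, $h_1\circ\rho(g)-\chi(g)\cdot h_1\in\mathbb{C}[V]$ is divisible by $f$. In particular, when $f$ is reduced and we let $V_\epsilon=\{x\in V: f(x)=h_1(x)-\epsilon=0\}$ for all $\epsilon\in\mathbb{C}$, then $h$ is an additive relative invariant if and only if $\rho(g)(V_\epsilon)=V_{\chi(g)\cdot\epsilon}$ for all $g\in G$ and $\epsilon\in\mathbb{C}$.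
   Context: A prehomogeneous vector space $(G,\rho,V)$ is a rational representation $\rho:G\to\mathrm{GL}(V)$ of a connected complex linear algebraic group $G$ on a finite-dimensional complex vector space $V$ having a (unique) Zariski open orbit $\Omega\subseteq V$. A relative invariant is a rational function $f$ on $V$, not identically $0$, for which there is a rational character $\chi:G\to\mathbb{G}_m=\mathrm{GL}_1(\mathbb{C})$ with $f(\rho(g)(v))=\chi(g)f(v)$ for all $v\in\Omega$, $g\in G$; then $\chi$ is the character corresponding to $f$. The basic relative invariants are the irreducible polynomials defining the distinct irreducible hypersurface components of $V\setminus\Omega$ (they are relative invariants). An additive relative invariant is a rational function $h$ on $V$ for which there is a homomorphism of algebraic groups $\Phi:G\to\mathbb{G}_a=(\mathbb{C},+)$ with $h(\rho(g)(v))-h(v)=\Phi(g)$ for all $v\in\Omega$, $g\in G$. $V(p)$ denotes the zero set of $p$. For polynomials $p_1,p_2,q$ on $V$ with $q$ irreducible and nonzero, $p_1$ and $p_2$ agree to order $k$ on $V(q)$ if $p_1-p_2\in(q)^{k+1}$ (equivalently, in coordinates, all partial derivatives of $p_1-p_2$ of order at most $k$ vanish on $V(q)$). *)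

(* Defs.v *)
From HB Require Import structures.
From mathcomp Require Import all_boot all_order all_algebra.
From mathcomp Require Import complex mpoly.
From mathcomp Require Import classical_sets reals.

Set Implicit Arguments.
Unset Strict Implicit.
Unset Printing Implicit Defensive.

Import GRing.Theory.
Local Open Scope ring_scope.
Local Open Scope classical_set_scope.

Notation "p %:F" := (FracField.tofrac p) : ring_scope.

Section Polynomials.
Variables (K : closedFieldType) (n : nat).
Implicit Types (p q : {mpoly K[n]}) (v : 'cV[K]_n).

Definition peval p v : K := p.@[fun i => v i ord0].

(* p \o A, as a polynomial: the i-th variable is replaced by the i-th
   coordinate of A *m v. *)
Definition pcomp_lin p (A : 'M[K]_n) : {mpoly K[n]} :=
  p \mPo [tuple \sum_(j < n) A i j *: 'X_j | i < n].

Definition pdvd p q : Prop := exists s, q = s * p.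

Definition pirreducible q : Prop :=
  [/\ q != 0, q \isn't a GRing.unit &
      forall a b, q = a * b -> a \is a GRing.unit \/ b \is a GRing.unit].

Definition pcoprime p q : Prop :=
  forall s, pdvd s p -> pdvd s q -> s \is a GRing.unit.

(* Square-free: no repeated factor. *)
Definition preduced p : Prop :=
  forall s, pdvd (s ^+ 2) p -> s \is a GRing.unit.

(* The ideal (q)^(k+1) is generated by q ^+ k.+1. *)
Definition agree_to_order (k : nat) q p1 p2 : Prop := pdvd (q ^+ k.+1) (p1 - p2).

(* rational_value h v c: h is defined at v, with value c. *)
Definition rational_value (h : {fraction {mpoly K[n]}}) v (c : K) : Prop :=
  exists p q, [/\ peval q v != 0, h = p%:F / q%:F & c = peval p v / peval q v].

End Polynomials.

Section Zariski.
Variables (K : closedFieldType) (n : nat).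
Implicit Types (p : {mpoly K[n]}) (W Y Z : set 'cV[K]_n).

Definition zero_set p : set 'cV[K]_n := [set v | peval p v = 0].

Definition zclosed Z : Prop :=
  exists S : set {mpoly K[n]}, Z = [set v | forall p, S p -> peval p v = 0].

Definition zopen Z : Prop := zclosed (~` Z).

Definition zirreducible Z : Prop :=
  Z !=set0 /\
  forall Y1 Y2, zclosed Y1 -> zclosed Y2 -> Z `<=` Y1 `|` Y2 ->
    Z `<=` Y1 \/ Z `<=` Y2.

Definition irreducible_component W Z : Prop :=
  [/\ zirreducible Z, Z `<=` W &
      forall Y, zirreducible Y -> Y `<=` W -> Z `<=` Y -> Y = Z].

(* p != 0 and p not a unit: p is non-constant. *)
Definition hypersurface Z : Prop :=
  exists p, [/\ p != 0, p \isn't a GRing.unit & Z = zero_set p].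

End Zariski.

(* Linear algebraic groups are realised as Zariski closed subgroups of GL_m;
   functions on such a group G are total functions on 'M_m of which only the
   restriction to G matters. *)
Section Groups.
Variables (K : closedFieldType) (m : nat).
Implicit Types (G Y Z : set 'M[K]_m) (phi : 'M[K]_m -> K).

(* The m * m matrix entries are used as coordinates on 'M_m. *)
Definition mxcoord (g : 'M[K]_m) : 'cV[K]_(m * m) := (mxvec g)^T.

Definition zclosed_mx Z : Prop :=
  exists2 Y : set 'cV[K]_(m * m), zclosed Y & Z = [set g | Y (mxcoord g)].

Record linear_algebraic_group G : Prop := LinearAlgebraicGroup {
  lag_unit : forall g, G g -> g \in unitmx;
  lag_one : G 1%:M;
  lag_mul : forall g h, G g -> G h -> G (g *m h);
  lag_inv : forall g, G g -> G (invmx g);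
  lag_closed : exists2 Z, zclosed_mx Z & G = Z `&` [set g | g \in unitmx] }.

Definition zconnected G : Prop :=
  forall Y Z, zclosed_mx Y -> zclosed_mx Z -> G `<=` Y `|` Z ->
    G `&` Y `&` Z = set0 -> G `<=` Y \/ G `<=` Z.

(* The coordinate ring of GL_m is generated by the entries and 1 / det. *)
Definition regular_on G phi : Prop :=
  exists (p : {mpoly K[m * m]}) (e : nat),
    forall g, G g -> phi g = peval p (mxcoord g) / \det g ^+ e.

Definition rational_character G (chi : 'M[K]_m -> K) : Prop :=
  [/\ regular_on G chi, forall g, G g -> chi g != 0 &
      forall g h, G g -> G h -> chi (g *m h) = chi g * chi h].

Definition additive_character G (Phi : 'M[K]_m -> K) : Prop :=
  regular_on G Phi /\
  forall g h, G g -> G h -> Phi (g *m h) = Phi g + Phi h.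

Definition rational_representation n G (rho : 'M[K]_m -> 'M[K]_n) : Prop :=
  [/\ forall i j, regular_on G (fun g => rho g i j), rho 1%:M = 1%:M &
      forall g h, G g -> G h -> rho (g *m h) = rho g *m rho h].

End Groups.

Section Prehomogeneous.
Variables (K : closedFieldType) (m n : nat).
Variables (G : set 'M[K]_m) (rho : 'M[K]_m -> 'M[K]_n) (Omega : set 'cV[K]_n).

Record prehomogeneous : Prop := Prehomogeneous {
  pv_group : linear_algebraic_group G;
  pv_connected : zconnected G;
  pv_rep : rational_representation G rho;
  pv_orbit : exists v0, Omega = [set rho g *m v0 | g in G];
  pv_open : zopen Omega }.

Definition relative_invariant (f : {fraction {mpoly K[n]}})
    (chi : 'M[K]_m -> K) : Prop :=
  [/\ f != 0, rational_character G chi &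
      forall g v, G g -> Omega v ->
        exists a b, [/\ rational_value f (rho g *m v) a,
                        rational_value f v b & a = chi g * b]].

Definition additive_relative_invariant (h : {fraction {mpoly K[n]}}) : Prop :=
  exists2 Phi : 'M[K]_m -> K, additive_character G Phi &
    forall g v, G g -> Omega v ->
      exists a b, [/\ rational_value h (rho g *m v) a,
                      rational_value h v b & a - b = Phi g].

Definition basic_relative_invariants (r : nat)
    (fs : 'I_r -> {mpoly K[n]}) : Prop :=
  [/\ forall i, pirreducible (fs i),
      injective (fun i => zero_set (fs i)) &
      forall Z, (irreducible_component (~` Omega) Z /\ hypersurface Z) <->
                (exists i, Z = zero_set (fs i))].

End Prehomogeneous.

Definition level_set (K : closedFieldType) (n : nat) (f h1 : {mpoly K[n]})
    (eps : K) : set 'cV[K]_n :=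
  [set x | peval f x = 0 /\ peval h1 x - eps = 0].

(* Main.v *)
Require Import Defs.
From HB Require Import structures.
From mathcomp Require Import all_boot all_order all_algebra.
From mathcomp Require Import complex mpoly.
From mathcomp Require Import classical_sets reals boolp.
From mathcomp Require Import zify ring.

(* On Omega the invariants f_i do not vanish, so h(rho(g) v) - h(v) equals
   D_g(v) / (chi(g) f(v)) with D_g = h1 o rho(g) - chi(g) h1. As Omega is
   Zariski dense, a value Phi(g) independent of v forces
   D_g = Phi(g) chi(g) f. Conversely, D_g and f are homogeneous of the same
   degree, so if f divides D_g then the quotient is a constant, and
   Phi(g) = D_g / (chi(g) f) is additive because Omega is stable under G, and
   regular because 1 / chi(g) = chi(g^-1). Divisibility by f amounts to
   divisibility by each f_i^k_i since the f_i are pairwise non-associated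
   primes of the factorial ring C[V].

   When f is reduced, the condition on the level sets says that D_g vanishes
   on each V(f_i) with k_i > 0. That f_i then divides D_g is the
   Nullstellensatz for an irreducible hypersurface: if f_i has positive degree
   in the last variable and does not divide D_g, a Bezout relation over the
   ring of polynomials in the other variables yields a nonzero polynomial in
   those variables that vanishes wherever the leading coefficient of f_i does
   not. *)

Set Implicit Arguments.
Unset Strict Implicit.
Unset Printing Implicit Defensive.

Import GRing.Theory.
Local Open Scope ring_scope.
Local Open Scope classical_set_scope.

(** * Divisibility and prime factorization in an integral domain *)

Section Divisibility.
Variable D : idomainType.
Implicit Types a b p q u : D.

(* At [{mpoly K[n]}], [rdvd] and [irreducible_elt] below are [pdvd] and
   [pirreducible] up to conversion; factorization also needs them at
   [{poly D}]. *)
Definition rdvd a b : Prop := exists s, b = s * a.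

Definition prime_elt p : Prop :=
  [/\ p != 0, p \isn't a GRing.unit &
      forall a b, rdvd p (a * b) -> rdvd p a \/ rdvd p b].

Definition irreducible_elt q : Prop :=
  [/\ q != 0, q \isn't a GRing.unit &
      forall a b, q = a * b -> a \is a GRing.unit \/ b \is a GRing.unit].

Definition prime_product a : Prop :=
  exists u s, [/\ u \is a GRing.unit, {in s, forall p, prime_elt p} &
                  a = u * \prod_(p <- s) p].

Lemma rdvd0 a : rdvd a 0.
Proof. by exists 0; rewrite mul0r. Qed.

Lemma rdvdD a b c : rdvd a b -> rdvd a c -> rdvd a (b + c).
Proof. by move=> [s ->] [t ->]; exists (s + t); rewrite mulrDl. Qed.

Lemma rdvdMl a b c : rdvd a b -> rdvd a (c * b).
Proof. by case=> s ->; exists (c * s); rewrite mulrA. Qed.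

Lemma rdvdMr a b c : rdvd a b -> rdvd a (b * c).
Proof. by rewrite mulrC; apply: rdvdMl. Qed.

Lemma rdvdBr a b c : rdvd a c -> rdvd a (b + c) -> rdvd a b.
Proof.
by move=> [t f] [s e]; exists (s - t); rewrite mulrBl -e -f addrK.
Qed.

Lemma rdvd_trans b a c : rdvd a b -> rdvd b c -> rdvd a c.
Proof. by move=> ab [s ->]; apply: rdvdMl. Qed.

Lemma rdvd_unit a u : u \is a GRing.unit -> rdvd a u -> a \is a GRing.unit.
Proof. by move=> uU [s e]; move: uU; rewrite e unitrM => /andP[]. Qed.

Lemma prime_rdvdX p a k : prime_elt p -> rdvd p (a ^+ k) -> rdvd p a.
Proof.
move=> [_ pU pP]; elim: k => [|k IH].
  by rewrite expr0 => /(rdvd_unit (unitr1 _)) pu; rewrite pu in pU.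
by rewrite exprS => /pP[].
Qed.

Lemma prime_rdvd_prod (I : eqType) (r : seq I) (F : I -> D) p :
  prime_elt p -> rdvd p (\prod_(i <- r) F i) ->
  exists2 i, i \in r & rdvd p (F i).
Proof.
move=> [_ pU pP]; elim: r => [|i r IH].
  by rewrite big_nil => /(rdvd_unit (unitr1 _)) pu; rewrite pu in pU.
rewrite big_cons => /pP[pi|/IH[j jr pj]].
  by exists i => //; rewrite mem_head.
by exists j => //; rewrite in_cons jr orbT.
Qed.

(** As [p] never divides [b], the factors [p] are split off [a] one by one. *)
Lemma prime_rdvd_mulX p a b k :
  prime_elt p -> rdvd (p ^+ k) (a * b) -> ~ rdvd p b -> rdvd (p ^+ k) a.
Proof.
move=> [p0 pU pP] + npb; elim: k a => [|k IH] a.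
  by move=> _; exists a; rewrite expr0 mulr1.
rewrite exprS => -[s e].
have /pP[[t a_eq]|//] : rdvd p (a * b).
  by exists (s * p ^+ k); rewrite e [p * _]mulrC mulrA.
have /IH[w t_eq] : rdvd (p ^+ k) (t * b).
  exists s; apply: (mulfI p0); rewrite [RHS]mulrCA -e a_eq.
  by rewrite mulrA [p * t]mulrC.
by exists w; rewrite a_eq t_eq -mulrA [p * _]mulrC.
Qed.

Lemma primeMunit p u : u \is a GRing.unit -> prime_elt p -> prime_elt (u * p).
Proof.
move=> uU [p0 pU pP].
have dvdE a : rdvd p a -> rdvd (u * p) a.
  by case=> s ->; exists (s / u); rewrite mulrA divrK.
split=> [||a b [s e]].
- by rewrite mulf_neq0 //; apply: contraTneq uU => ->; rewrite unitr0.
- by rewrite unitrM uU.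
- have /pP[/dvdE|/dvdE] : rdvd p (a * b) by exists (s * u); rewrite -mulrA.
    by left.
  by right.
Qed.

Lemma rdvd_prime p q : prime_elt p -> prime_elt q -> rdvd p q ->
  exists2 u, u \is a GRing.unit & q = u * p.
Proof.
move=> [p0 pU _] [q0 _ qP] [w e]; exists w => //.
have [[t w_eq]|[t p_eq]] : rdvd q w \/ rdvd q p.
- by apply: qP; exists 1; rewrite mul1r.
- have tp : t * p = 1.
    by apply: (mulfI q0); rewrite mulr1 [RHS]e w_eq mulrA [q * t]mulrC.
  by case/negP: pU; apply/unitrP; exists t; rewrite [p * t]mulrC.
- apply/unitrP; exists t; split; apply: (mulIf q0);
    by rewrite mul1r ?[t * w]mulrC -mulrA -p_eq.
Qed.

Lemma rdvd_irreducible p q : irreducible_elt p -> irreducible_elt q ->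
  rdvd p q -> exists2 u, u \is a GRing.unit & q = u * p.
Proof.
move=> [_ pU _] [_ _ qI] [u e]; exists u => //.
by case: (qI _ _ e) => // pu; rewrite pu in pU.
Qed.

Lemma prime_product1 u : u \is a GRing.unit -> prime_product u.
Proof. by move=> uU; exists u, [::]; split; rewrite ?big_nil ?mulr1. Qed.

Lemma prime_productP p : prime_elt p -> prime_product p.
Proof.
move=> pp; exists 1, [:: p]; split; rewrite ?unitr1 ?big_seq1 ?mul1r //.
by move=> q; rewrite inE => /eqP ->.
Qed.

Lemma prime_productM a b :
  prime_product a -> prime_product b -> prime_product (a * b).
Proof.
move=> [u [s [uU sP ->]]] [v [t [vU tP ->]]].
exists (u * v), (s ++ t); split.
- by rewrite unitrM uU.
- by move=> p; rewrite mem_cat => /orP[/sP|/tP].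
- by rewrite big_cat mulrACA.
Qed.

End Divisibility.

(** Existence of prime factorizations already forces their uniqueness, so these are the unique
    factorization domains. *)
Definition factorial_ring (D : idomainType) : Prop :=
  forall a : D, a != 0 -> prime_product a.

Lemma irreducible_prime (D : idomainType) (q : D) :
  factorial_ring D -> irreducible_elt q -> prime_elt q.
Proof.
move=> DF [q0 qU qI]; have [u [[|p s] [uU sP q_eq]]] := DF q q0.
  by rewrite q_eq big_nil mulr1 uU in qU.
have pp : prime_elt p by apply: sP; rewrite mem_head.
rewrite big_cons mulrCA mulrC in q_eq; rewrite q_eq.
apply: primeMunit => //.
by case: (qI _ _ q_eq) => // pU; case: pp => _; rewrite pU.
Qed.

(** Induction along [s]: [q i] does not divide the product over the tail, so [q i ^+ k i] divides
    the quotient of [a] by that product. *)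
Lemma coprime_powers_rdvd (D : idomainType) (I : eqType) (s : seq I)
    (q : I -> D) (k : I -> nat) (a : D) :
  uniq s -> (forall i, prime_elt (q i)) ->
  (forall i j, rdvd (q i) (q j) -> i = j) ->
  (forall i, rdvd (q i ^+ k i) a) -> rdvd (\prod_(i <- s) q i ^+ k i) a.
Proof.
move=> + qP q_inj qa; elim: s => [_|i s IH /= /andP[is_ /IH[t a_eq]]].
  by exists a; rewrite big_nil mulr1.
have [||w t_eq] := @prime_rdvd_mulX _ (q i) t (\prod_(j <- s) q j ^+ k j)
    (k i) (qP i).
- by rewrite -a_eq.
- move=> /(prime_rdvd_prod (qP i))[j js /(prime_rdvdX (qP i))/q_inj ij].
  by rewrite ij js in is_.
- by exists w; rewrite big_cons mulrA -t_eq.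
Qed.

(** * Transport along a ring isomorphism *)

Section Isomorphism.
Variables (A B : idomainType) (f : {rmorphism A -> B}) (g : {rmorphism B -> A}).
Hypotheses (fK : cancel f g) (gK : cancel g f).

Lemma rdvd_iso a b : rdvd (f a) (f b) <-> rdvd a b.
Proof.
split=> [[s e]|[s ->]]; last by exists (f s); rewrite rmorphM.
by exists (g s); apply: (can_inj fK); rewrite rmorphM gK.
Qed.

Lemma unit_iso a : (f a \is a GRing.unit) = (a \is a GRing.unit).
Proof.
by apply/idP/idP => [/(rmorph_unit g)|]; [rewrite fK | apply: rmorph_unit].
Qed.

Lemma prime_iso p : prime_elt (f p) <-> prime_elt p.
Proof.
have f0 a : (f a != 0) = (a != 0) by rewrite -(rmorph0 f) (can_eq fK).
split=> -[p0 pU pP]; split; rewrite ?f0 ?unit_iso // -?f0 -?unit_iso //.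
- move=> a b /rdvd_iso; rewrite rmorphM => /pP[] /rdvd_iso; by [left|right].
- move=> a b; rewrite -[a]gK -[b]gK -rmorphM => /rdvd_iso /pP[] /rdvd_iso;
  by [left|right].
Qed.

Lemma factorial_iso : factorial_ring B -> factorial_ring A.
Proof.
move=> BF a a0; have [|u [s [uU sP e]]] := BF (f a).
  by rewrite -(rmorph0 f) (can_eq fK).
exists (g u), (map g s); split.
- exact: rmorph_unit.
- by move=> _ /mapP[p /sP pp ->]; apply/prime_iso; rewrite gK.
- by rewrite -[a]fK e rmorphM rmorph_prod big_map.
Qed.

End Isomorphism.

(** * Unique factorization of polynomials *)

Section PolyFactorial.
Variable D : idomainType.
Implicit Types (p c : D) (f g : {poly D}).

Lemma rdvd_polyC p f : rdvd p%:P f <-> forall i, rdvd p f`_i.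
Proof.
split=> [[s ->] i|]; first by exists s`_i; rewrite coefMC.
elim/poly_ind: f => [|f c IH] pf; first exact: rdvd0.
apply: rdvdD.
  apply/rdvdMr/IH=> i.
  by have := pf i.+1; rewrite coefD coefMX coefC addr0.
have [s] := pf 0; rewrite coefD coefMX coefC add0r => ->.
by exists s%:P; rewrite polyCM.
Qed.

Lemma rdvd_polyCE p c : rdvd p%:P c%:P <-> rdvd p c.
Proof.
split=> [/rdvd_polyC/(_ 0)|[s ->]]; first by rewrite coefC.
by exists s%:P; rewrite polyCM.
Qed.

Lemma unit_polyC c : (c%:P \is a GRing.unit) = (c \is a GRing.unit).
Proof.
rewrite poly_unitE coefC size_polyC.
by case: (eqVneq c 0) => //= ->; rewrite unitr0.
Qed.

Lemma rdvd_MX p f : rdvd p%:P (f * 'X) -> rdvd p%:P f.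
Proof.
move=> /rdvd_polyC pf; apply/rdvd_polyC => i.
by have := pf i.+1; rewrite coefMX.
Qed.

(* Gauss: split off constant terms, so that the constant term of the product
   decides which factor to shorten. *)
Lemma prime_polyC p : prime_elt p%:P <-> prime_elt p.
Proof.
split=> -[p0 pU pP].
  split=> [||a b]; first by rewrite -polyC_eq0.
    by rewrite -unit_polyC.
  rewrite -rdvd_polyCE polyCM => /pP[] /rdvd_polyCE; by [left|right].
split; [by rewrite polyC_eq0 | by rewrite unit_polyC | ].
elim/poly_ind => [|f c IHf] g; first by left; apply: rdvd0.
elim/poly_ind: g => [|g e IHg] pfg; first by right; apply: rdvd0.
have : rdvd p (c * e).
  move/rdvd_polyC/(_ 0): pfg.
  by rewrite coef0M !coefD !coefMX !coefC !add0r.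
move=> /pP[] /rdvd_polyCE pc.
- have [|pf|] := IHf (g * 'X + e%:P); last by right.
    apply: rdvd_MX; rewrite mulrAC; apply: (rdvdBr (rdvdMr (g * 'X + e%:P) pc)).
    by rewrite -mulrDl.
  by left; apply: (rdvdD _ pc); apply: rdvdMr.
- have [|pf|pg] := IHg; last by right; apply: (rdvdD _ pc); apply: rdvdMr.
    apply: rdvd_MX; rewrite -mulrA; apply: (rdvdBr (rdvdMl (f * 'X + c%:P) pc)).
    by rewrite -mulrDr.
  by left.
Qed.

End PolyFactorial.

Import Pdiv.Idomain Pdiv.CommonIdomain.

(** * Primitive polynomials and Gauss's lemma *)

Section GaussLemma.
Variable D : idomainType.
Implicit Types (p c : D) (f g : {poly D}).

(** Trivial content, stated through prime constants instead of gcds. Over a field there are no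
    primes and every polynomial is primitive. *)
Definition primitive_poly g : Prop :=
  forall p, prime_elt p -> ~ rdvd p%:P g.

Lemma primitive_mulIr f g :
  primitive_poly (f * g) -> primitive_poly f.
Proof. by move=> fgP p pp pf; apply: (fgP p pp); apply: rdvdMr. Qed.

(* The prime factors of [c] divide [s * g], hence [s], and can be cancelled
   one at a time. *)
Lemma primitive_cancel c f g s :
  prime_product c -> c != 0 -> primitive_poly g ->
  c%:P * f = s * g -> rdvd g f.
Proof.
move=> [u [r [uU rP ->]]] + gP; rewrite mulf_eq0 negb_or => /andP[_ _].
elim: r rP s => [|p r IH] rP s.
  rewrite big_nil mulr1 => e; exists (u^-1%:P * s).
  by rewrite -mulrA -e mulrA -polyCM mulVr // mul1r.
have pp : prime_elt p by apply: rP; rewrite mem_head.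
have /prime_polyC[p0 _ pP] := pp.
rewrite big_cons mulrCA polyCM -mulrA => e.
have [[t s_eq]|/(gP p pp)//] : rdvd p%:P s \/ rdvd p%:P g.
  apply: pP; rewrite -e.
  by exists ((u * \prod_(q <- r) q)%:P * f); rewrite mulrC.
apply: (IH _ t) => [q qr|]; first by apply: rP; rewrite in_cons qr orbT.
by apply: (mulfI p0); rewrite e s_eq -mulrA mulrCA.
Qed.

(** [p] divides, hence is associated to, some [q] in [r]; [q] is dropped and the unit between them
    goes into [v]. The size equation drives the induction in [primitive_part]. *)
Lemma prime_product_cancel p c u (r : seq D) :
  prime_elt p -> u \is a GRing.unit -> {in r, forall q, prime_elt q} ->
  p * c = u * \prod_(q <- r) q ->
  exists v t, [/\ v \is a GRing.unit, {in t, forall q, prime_elt q},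
                  c = v * \prod_(q <- t) q & size r = (size t).+1].
Proof.
move=> pp uU rP e; have [p0 pU pP] := pp.
have /pP[/(rdvd_unit uU)|] : rdvd p (u * \prod_(q <- r) q).
- by exists c; rewrite [RHS]mulrC -e.
- by move=> pu; rewrite pu in pU.
move=> /(prime_rdvd_prod pp)[q qr pq].
have [w wU q_eq] := rdvd_prime pp (rP q qr) pq.
exists (u * w), (rem q r); split.
- by rewrite unitrM uU.
- by move=> x /mem_rem /rP.
- apply: (mulfI p0); rewrite e (perm_big _ (perm_to_rem qr)) big_cons /=.
  set B := \prod_(j <- _) j; rewrite q_eq [RHS]mulrA [p * _]mulrC.
  by rewrite !mulrA.
- by rewrite size_rem // prednK //; case: (r) qr.
Qed.

(** Induction on the number of primes in the leading coefficient: each prime constant pulled out of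
    [f] removes one, and a unit leading coefficient leaves none to pull out. *)
Lemma primitive_part f : factorial_ring D -> f != 0 ->
  exists c g, [/\ c != 0, primitive_poly g & f = c%:P * g].
Proof.
move=> DF f0.
have [u [r [uU rP]]] : prime_product (lead_coef f).
  by apply: DF; rewrite lead_coef_eq0.
elim: {r}(size r) {-2}r (erefl (size r)) u uU rP f f0
  => [|k IH] r rk u uU rP f f0 e.
  exists 1, f; split; rewrite ?oner_neq0 ?mul1r // => p pp [s f_eq].
  have [_ /negP + _] := pp; apply; apply: rdvd_unit uU _.
  rewrite (size0nil rk) big_nil mulr1 in e.
  by exists (lead_coef s); rewrite -e f_eq lead_coefM lead_coefC.
have [fP|] := pselect (primitive_poly f).
  by exists 1, f; rewrite oner_neq0 mul1r.
move=> /existsNP[p /not_implyP[pp /contrapT[s f_eq]]].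
have [p0 _ _] := pp.
rewrite f_eq lead_coefM lead_coefC mulrC in e.
have [v [t [vU tP e' rt]]] := prime_product_cancel pp uU rP e.
have s0 : s != 0 by apply: contraNneq f0 => s0; rewrite f_eq s0 mul0r.
have [|c [g [c0 gP s_eq]]] := IH t _ v vU tP s s0 e'.
  by move: rt; rewrite rk => -[].
exists (p * c), g; split=> //; first by rewrite mulf_neq0.
by rewrite f_eq s_eq polyCM mulrC mulrA.
Qed.

Lemma primitive_unit f :
  factorial_ring D -> primitive_poly f -> size f = 1%N -> f \is a GRing.unit.
Proof.
move=> DF fP f1; have /size1_polyC f_eq : (size f <= 1)%N by rewrite f1.
rewrite f_eq unit_polyC.
have f0 : f`_0 != 0 by rewrite -polyC_eq0 -f_eq -size_poly_eq0 f1.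
have [u [[|p r] [uU rP e]]] := DF _ f0; first by rewrite e big_nil mulr1.
case: (fP p (rP p (mem_head _ _))); rewrite f_eq rdvd_polyCE e big_cons.
by exists (u * \prod_(q <- r) q); rewrite mulrCA mulrC.
Qed.

(* A proper pseudo-gcd of [g] and [a] would have a primitive part properly
   dividing [g]. *)
Lemma primitive_prime g :
  factorial_ring D -> primitive_poly g -> (1 < size g)%N ->
  (forall a b, g = a * b -> size a = 1%N \/ size b = 1%N) -> prime_elt g.
Proof.
move=> DF gP g1 gI.
have g0 : g != 0 by rewrite -size_poly_gt0 ltnW.
(* Here [%|] is divisibility up to a nonzero constant multiple; primitivity of [g] removes the
   constant. *)
have dvd_lift a : (g %| a)%R -> rdvd g a.
  move=> /Pdiv.WeakIdomain.dvdpP[[c s] /= c0 e].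
  by apply: (primitive_cancel (DF c c0) c0 gP (s := s)); rewrite mul_polyC.
split=> // [|a b /= [w ab_eq]].
  by apply/negP; rewrite poly_unitE => /andP[/eqP gs]; rewrite gs in g1.
set e := gcdp g a.
have e0 : e != 0 by rewrite gcdp_eq0 (negPf g0).
have [d [e' [d0 e'P e_eq]]] := primitive_part DF e0.
have ee' : size e' = size e by rewrite e_eq mul_polyC size_scale.
have [t g_eq] : rdvd e' g.
  have /Pdiv.WeakIdomain.dvdpP[[c s] /= c0 ce] : (e %| g)%R by apply: dvdp_gcdl.
  apply: (primitive_cancel (DF c c0) c0 e'P (s := s * d%:P)).
  by rewrite mul_polyC ce e_eq mulrA.
(* The pseudo-gcd is either associated to [g], which then divides [a], or of degree zero, and then
   [g] is coprime to [a] and divides [b]. *)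
have [t1|e1] := gI _ _ g_eq.
- left; apply: dvd_lift.
  have [t0 e'0] : t != 0 /\ e' != 0.
    by apply/andP; rewrite -negb_or -mulf_eq0 -g_eq.
  have : (e %= g)%R.
    rewrite -(dvdp_size_eqp (dvdp_gcdl _ _)) -/e -ee' g_eq size_mul //.
    by rewrite t1 add1n.
  by move=> eg; rewrite -(eqp_dvdl _ eg) dvdp_gcdr.
- right; apply: dvd_lift.
  have cop : coprimep g a by rewrite coprimep_def -/e -ee' e1.
  by rewrite -(Gauss_dvdpr _ cop) ab_eq dvdp_mull.
Qed.

(** The content factors in [D], whose primes stay prime as constants. By induction on size, the
    primitive part is a unit, a prime, or a product of two shorter primitive polynomials. *)
Lemma factorial_poly : factorial_ring D -> factorial_ring {poly D}.
Proof.
move=> DF f f0; have [c [g [c0 gP f_eq]]] := primitive_part DF f0.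
rewrite f_eq; apply: prime_productM.
  have [u [r [uU rP ->]]] := DF c c0.
  rewrite polyCM; apply: prime_productM.
    by apply: prime_product1; rewrite unit_polyC.
  exists 1, (map polyC r); split.
  - exact: unitr1.
  - by move=> _ /mapP[p /rP pp ->]; apply/prime_polyC.
  - by rewrite mul1r rmorph_prod big_map.
have g0 : g != 0 by apply: contraNneq f0 => g0; rewrite f_eq g0 mulr0.
elim: {g}(size g) {-2}g (leqnn (size g)) gP g0 {f_eq} => [|k IH] g gk gP g0.
  by move: gk; rewrite leqn0 size_poly_eq0 (negPf g0).
have [g1|g1|/esym g1] := ltngtP 1%N (size g); last 2 first.
- by move: g0; rewrite -size_poly_gt0 lt0n; case: (size g) g1 => [|[]].
- by apply: prime_product1; apply: primitive_unit.
have [gI|] := pselect (forall a b, g = a * b -> size a = 1%N \/ size b = 1%N).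
  by apply: prime_productP; apply: primitive_prime.
move=> /existsNP[a /existsNP[b /not_implyP[g_eq /not_orP[/eqP a1 /eqP b1]]]].
have [a0 b0] : a != 0 /\ b != 0 by apply/andP; rewrite -negb_or -mulf_eq0 -g_eq.
have as0 : (0 < size a)%N by rewrite size_poly_gt0.
have bs0 : (0 < size b)%N by rewrite size_poly_gt0.
have ab_size : size g = (size a + size b).-1%N by rewrite g_eq size_mul.
rewrite g_eq; apply: prime_productM; apply: IH => //.
- by lia.
- by apply: (primitive_mulIr (g := b)); rewrite -g_eq.
- by lia.
- by apply: (primitive_mulIr (g := a)); rewrite mulrC -g_eq.
Qed.

(** For the pseudo-gcd [e], with [c *: g = s * e], primality makes [g] divide [s] or [e]. In the
    first case [e] is constant; in the second [g] divides a constant multiple of [f], hence [f], as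
    it is too long to divide a constant. *)
Lemma prime_coprimep g f :
  prime_elt g -> (1 < size g)%N -> ~ rdvd g f -> coprimep g f.
Proof.
move=> [g0 gU gP] g1 ngf.
have dvd_const c a : c != 0 -> rdvd g (c%:P * a) -> rdvd g a.
  move=> c0 /gP[|//] [s e].
  have s0 : s != 0 by apply: contraNneq c0 => s0; rewrite -polyC_eq0 e s0 mul0r.
  have : (size g <= size c%:P)%N.
    by rewrite e size_mul // (polySpred s0) addSn /= leq_addl.
  by rewrite size_polyC c0 leqNgt g1.
set e := gcdp g f.
have /Pdiv.WeakIdomain.dvdpP[[c s] /= c0 ce] : (e %| g)%R by apply: dvdp_gcdl.
have [|[t s_eq]|[t e_eq]] := gP s e.
- by exists c%:P; rewrite -ce mul_polyC.
- rewrite coprimep_def -/e.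
  have te : c%:P = t * e.
    by apply: (mulIf g0); rewrite mul_polyC ce s_eq mulrAC.
  have [t0 e0] : t != 0 /\ e != 0.
    by apply/andP; rewrite -negb_or -mulf_eq0 -te polyC_eq0.
  have := size_mul t0 e0.
  rewrite -te size_polyC c0 (polySpred t0) (polySpred e0) addSn addnS /=.
  by move=> [] /esym /eqP; rewrite addn_eq0 => /andP[_ /eqP ->].
- case: ngf.
  have /Pdiv.WeakIdomain.dvdpP[[d w] /= d0 de] : (e %| f)%R by apply: dvdp_gcdr.
  apply: (dvd_const d) => //; exists (w * t).
  by rewrite mul_polyC de e_eq mulrA.
Qed.

End GaussLemma.

(** * Multivariate polynomials *)

Section MPolyRecursion.
Variable n : nat.

Section Iso.
Variable K : comNzRingType.

(** The inverse of [muni], which singles out the last variable. *)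
Definition muni_inv (q : {poly {mpoly K[n]}}) : {mpoly K[n.+1]} :=
  horner_eval 'X_ord_max (map_poly (@mwiden n K) q).

HB.instance Definition _ := GRing.RMorphism.copy muni_inv
  (horner_eval ('X_ord_max : {mpoly K[n.+1]}) \o map_poly (@mwiden n K)).

Lemma muni_invC p : muni_inv p%:P = mwiden p.
Proof. by rewrite /muni_inv map_polyC horner_evalE hornerC. Qed.

Lemma muni_invX : muni_inv 'X = 'X_ord_max.
Proof. by rewrite /muni_inv map_polyX horner_evalE hornerX. Qed.

Lemma muniX_max : muni ('X_ord_max : {mpoly K[n.+1]}) = 'X.
Proof.
rewrite muniE msuppX big_seq1 mcoeffX eqxx scale1r mnm1E eqxx expr1.
rewrite (_ : [multinom _ | _ < n] = 0%MM) ?mpolyX0 ?scale1r //.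
by apply/mnmP => i; rewrite mnmE mnm1E mnm0E -val_eqE /= gtn_eqF.
Qed.

Lemma muniX_widen (i : 'I_n) :
  muni ('X_(widen_ord (leqnSn n) i) : {mpoly K[n.+1]}) = ('X_i)%:P.
Proof.
rewrite muniE msuppX big_seq1 mcoeffX eqxx scale1r mnm1E.
rewrite (_ : (_ == ord_max) = false); last by rewrite -val_eqE /= ltn_eqF.
rewrite expr0 (_ : [multinom _ | _ < n] = U_(i)%MM) ?alg_polyC //.
by apply/mnmP => j; rewrite mnmE !mnm1E -!val_eqE.
Qed.

Lemma mpoly_rmorph_ext (S : nzRingType) m
    (f g : {rmorphism {mpoly K[m]} -> S}) :
  (forall c, f c%:MP = g c%:MP) -> (forall i, f 'X_i = g 'X_i) -> f =1 g.
Proof.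
move=> fgC fgX p; rewrite [p]mpolyE (rmorph_sum f) (rmorph_sum g).
apply: eq_bigr => u _.
rewrite -mul_mpolyC (rmorphM f) (rmorphM g) fgC mpolyXE_id; congr (_ * _).
rewrite (rmorph_prod f) (rmorph_prod g).
by apply: eq_bigr => i _; rewrite (rmorphXn f) (rmorphXn g) fgX.
Qed.

Lemma muniK : cancel (@muni n K) muni_inv.
Proof.
apply: (mpoly_rmorph_ext (f := muni_inv \o @muni n K) (g := idfun)) => [c|i] /=.
  by rewrite muniC muni_invC mwidenC.
case: (unliftP ord_max i) => [j ->|->]; last by rewrite muniX_max muni_invX.
have -> : lift ord_max j = widen_ord (leqnSn n) j.
  by apply: val_inj; rewrite /= /bump leqNgt ltn_ord.
rewrite muniX_widen muni_invC mwidenX; congr 'X_[_].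
exact: mnmwiden1.
Qed.

Lemma mwiden_muni p : muni (mwiden p) = p%:P :> {poly {mpoly K[n]}}.
Proof.
apply: (mpoly_rmorph_ext (f := @muni n K \o @mwiden n K) (g := polyC))
  => [c|i] /=.
  by rewrite mwidenC muniC.
by rewrite mwidenX mnmwiden1 muniX_widen.
Qed.

Lemma muni_invK : cancel muni_inv (@muni n K).
Proof.
elim/poly_ind => [|q c IH]; first by rewrite !rmorph0.
rewrite (rmorphD muni_inv) (rmorphM muni_inv) /= muni_invX muni_invC.
by rewrite muniD muniM IH muniX_max mwiden_muni.
Qed.

Definition extend_point (w : 'I_n -> K) (x : K) (i : 'I_n.+1) : K :=
  if unlift ord_max i is Some j then w j else x.

Lemma meval_extend w x (q : {mpoly K[n.+1]}) :
  q.@[extend_point w x] = (map_poly (meval w) (muni q)).[x].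
Proof.
pose phi := horner_eval x \o map_poly (meval w) \o @muni n K.
apply: (mpoly_rmorph_ext (f := meval (extend_point w x)) (g := phi)) => [c|i];
  rewrite /phi /=.
  by rewrite muniC map_polyC horner_evalE hornerC /= !mevalC.
rewrite mevalXU /extend_point; case: unliftP => [j ->|->].
  have -> : lift ord_max j = widen_ord (leqnSn n) j.
    by apply: val_inj; rewrite /= /bump leqNgt ltn_ord.
  by rewrite muniX_widen map_polyC horner_evalE hornerC /= mevalXU.
by rewrite muniX_max map_polyX horner_evalE hornerX.
Qed.

End Iso.
End MPolyRecursion.

(** * Factoriality in several variables *)

Section MPolyFactorial.
Variable K : fieldType.

Lemma mpoly0_const (p : {mpoly K[0]}) : p = (p@_0%MM)%:MP.
Proof.
apply/mpolyP => m; rewrite mcoeffC.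
by have -> : m = 0%MM; [apply/mnmP => -[] | rewrite eqxx mulr1].
Qed.

Lemma mpoly0_unit (p : {mpoly K[0]}) : p != 0 -> p \is a GRing.unit.
Proof.
rewrite [p]mpoly0_const mpolyC_eq0 => c0.
by rewrite rmorph_unit // unitfE.
Qed.

Definition muni_iso n : {rmorphism ({mpoly K[n.+1]} : idomainType) ->
  ({poly {mpoly K[n]}} : idomainType)} := @muni n K.

Definition muni_inv_iso n : {rmorphism ({poly {mpoly K[n]}} : idomainType) ->
  ({mpoly K[n.+1]} : idomainType)} := @muni_inv n K.

Lemma muni_isoK n : cancel (muni_iso n) (muni_inv_iso n).
Proof. exact: muniK. Qed.

Lemma muni_inv_isoK n : cancel (muni_inv_iso n) (muni_iso n).
Proof. exact: muni_invK. Qed.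

Lemma rdvd_muni n (p q : {mpoly K[n.+1]}) :
  rdvd (muni p) (muni q) <-> rdvd p q.
Proof. exact: (rdvd_iso (@muni_isoK n) (@muni_inv_isoK n) p q). Qed.

Lemma prime_muni n (p : {mpoly K[n.+1]}) :
  prime_elt (muni p) <-> prime_elt p.
Proof. exact: (prime_iso (@muni_isoK n) (@muni_inv_isoK n) p). Qed.

Lemma factorial_mpoly n : factorial_ring {mpoly K[n]}.
Proof.
elim: n => [|n IH]; first by move=> p /mpoly0_unit/prime_product1.
by have /(factorial_iso (@muni_isoK n) (@muni_inv_isoK n)) := factorial_poly IH.
Qed.

End MPolyFactorial.

(** * Nullstellensatz for a prime polynomial *)

Section Nullstellensatz.
Variable K : closedFieldType.

(** Pick [w] where the leading coefficient in the last variable survives; the univariate polynomial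
    left over has a non-root in the closed field [K]. *)
Lemma mpoly_nonzero n (p : {mpoly K[n]}) : p != 0 -> exists v, p.@[v] != 0.
Proof.
elim: n p => [|n IH] p p0.
  exists (fun=> 0); apply: contraNneq p0.
  rewrite {1}[p]mpoly0_const mevalC => c0.
  by rewrite [p]mpoly0_const c0 mpolyC0.
have P0 : muni p != 0.
  by rewrite -(rmorph0 (@muni n K)) (can_eq (muniK (K := K))).
have [w lw] : exists w, (lead_coef (muni p)).@[w] != 0.
  by apply: IH; rewrite lead_coef_eq0.
have /closed_nonrootP[x xP] : map_poly (meval w) (muni p) != 0.
  by rewrite -lead_coef_eq0 lead_coef_map_eq.
by exists (extend_point w x); rewrite meval_extend.
Qed.

Lemma prime_vanishing n (q p : {mpoly K[n]}) :
  prime_elt q -> (forall v, q.@[v] = 0 -> p.@[v] = 0) -> rdvd q p.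
Proof.
elim: n q p => [|n IH] q p qp qv.
  by have [/mpoly0_unit q0 /negP[]] := qp.
move/prime_muni: qp => qp; apply/rdvd_muni.
have {}qv w x : (map_poly (meval w) (muni q)).[x] = 0 ->
    (map_poly (meval w) (muni p)).[x] = 0.
  by move: (qv (extend_point w x)); rewrite !meval_extend.
move: (muni q) (muni p) qp qv => {q p} q p qp qv.
have [q0 qU _] := qp.
have [q1|q1] := leqP (size q) 1.
  (* [q] does not involve the last variable: above a zero [w] of [q], [p] vanishes for every [x], so
     all its coefficients vanish at [w] and induction applies to each. *)
  have q_eq := size1_polyC q1; rewrite q_eq in qp qv *.
  apply/rdvd_polyC => i; apply: IH; first exact/prime_polyC.
  move=> w qw; rewrite -coef_map /=.
  have -> : map_poly (meval w) p = 0; last by rewrite coef0.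
  apply/eqP/negPn/negP => /closed_nonrootP[x /negP]; apply.
  by apply/rootP/qv; rewrite map_polyC hornerC.
apply: contrapT => npq.
have /Bezout_coprimepP[[u v]] := prime_coprimep qp q1 npq.
case/eqpP => -[c1 c2] /= /andP[_ c20] e.
(* At such a [w] the degree of [q] is kept, so [q] has a root [x] above [w], where [p] vanishes too;
   the Bezout relation then forces [c2.@[w] = 0]. *)
have [w] : exists w, (c2 * lead_coef q).@[w] != 0.
  by apply: mpoly_nonzero; rewrite mulf_neq0 // lead_coef_eq0.
rewrite mevalM mulf_eq0 negb_or => /andP[c2w lw].
have /closed_rootP[x /rootP xq] : size (map_poly (meval w) q) != 1%N.
  by rewrite size_map_poly_id0 // gtn_eqF.
case/eqP: c2w; move/(congr1 (fun s => (map_poly (meval w) s).[x])): e.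
rewrite !map_polyZ !rmorphD !rmorphM rmorph1 !hornerZ !hornerD !hornerM /=.
by rewrite hornerC xq (qv _ _ xq) !mulr0 addr0 mulr0 mulr1 => ->.
Qed.

End Nullstellensatz.

(** * Regular functions on a linear group *)

Section RegularFunctions.
Variables (K : closedFieldType) (m : nat) (G : set 'M[K]_m).
Hypothesis G_unit : forall g, G g -> g \in unitmx.
Implicit Types (phi psi : 'M[K]_m -> K).

Let coord (g : 'M[K]_m) (k : 'I_(m * m)) : K := mxcoord g k ord0.

Definition generic_mx : 'M[{mpoly K[m * m]}]_m :=
  \matrix_(i, j) 'X_(mxvec_index i j).

Lemma map_generic_mx g : map_mx (meval (coord g)) generic_mx = g.
Proof.
by apply/matrixP => i j; rewrite !mxE /= mevalXU /coord /mxcoord mxE mxvecE.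
Qed.

Lemma regular_ext phi psi :
  (forall g, G g -> phi g = psi g) -> regular_on G phi -> regular_on G psi.
Proof.
by move=> e [p [k h]]; exists p, k => g Gg; rewrite -e // h.
Qed.

Lemma regular_poly (p : {mpoly K[m * m]}) :
  regular_on G (fun g => p.@[coord g]).
Proof. by exists p, 0%N => g _; rewrite expr0 divr1. Qed.

Lemma regular_cst c : regular_on G (fun=> c).
Proof.
by apply: regular_ext (regular_poly c%:MP) => g _; rewrite mevalC.
Qed.

Lemma regular_det : regular_on G (fun g => \det g).
Proof.
apply: regular_ext (regular_poly (\det generic_mx)) => g _.
by rewrite -det_map_mx map_generic_mx.
Qed.

Lemma regular_adj i j : regular_on G (fun g => (\adj g) i j).
Proof.
apply: regular_ext (regular_poly ((\adj generic_mx) i j)) => g _.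
by rewrite -[in RHS](map_generic_mx g) -map_mx_adj [RHS]mxE.
Qed.

Lemma regular_invdet : regular_on G (fun g => (\det g)^-1).
Proof. by exists 1, 1%N => g _; rewrite /peval meval1 expr1 div1r. Qed.

Lemma regularM phi psi : regular_on G phi -> regular_on G psi ->
  regular_on G (fun g => phi g * psi g).
Proof.
move=> [p [a pE]] [q [b qE]]; exists (p * q), (a + b)%N => g Gg.
by rewrite pE // qE // /peval mevalM exprD invfM mulrACA.
Qed.

(** The sum is put over a common power of the determinant, which is a polynomial in the entries and
    so may enter the numerators. *)
Lemma regularD phi psi : regular_on G phi -> regular_on G psi ->
  regular_on G (fun g => phi g + psi g).
Proof.
move=> [p [a pE]] [q [b qE]].
pose d := \det generic_mx.
exists (p * d ^+ b + q * d ^+ a), (a + b)%N => g Gg.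
have dE : d.@[coord g] = \det g by rewrite -det_map_mx map_generic_mx.
have g0 : \det g != 0 by rewrite -unitfE -unitmxE G_unit.
rewrite pE // qE // /peval mevalD !mevalM !rmorphXn /= -/(coord g) dE.
by rewrite exprD addf_div ?expf_neq0.
Qed.

Lemma regularX phi k : regular_on G phi -> regular_on G (fun g => phi g ^+ k).
Proof.
move=> phiP; elim: k => [|k IH].
  by apply: regular_ext (regular_cst 1) => g _; rewrite expr0.
by apply: regular_ext (regularM phiP IH) => g _; rewrite exprS.
Qed.

Lemma regular_prod (I : Type) (s : seq I) (F : I -> 'M[K]_m -> K) :
  (forall i, regular_on G (F i)) ->
  regular_on G (fun g => \prod_(i <- s) F i g).
Proof.
move=> FP; elim: s => [|i s IH].
  by apply: regular_ext (regular_cst 1) => g _; rewrite big_nil.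
by apply: regular_ext (regularM (FP i) IH) => g _; rewrite big_cons.
Qed.

Lemma regular_sum (I : Type) (s : seq I) (F : I -> 'M[K]_m -> K) :
  (forall i, regular_on G (F i)) ->
  regular_on G (fun g => \sum_(i <- s) F i g).
Proof.
move=> FP; elim: s => [|i s IH].
  by apply: regular_ext (regular_cst 0) => g _; rewrite big_nil.
by apply: regular_ext (regularD (FP i) IH) => g _; rewrite big_cons.
Qed.

Lemma regular_meval N (p : {mpoly K[N]}) (F : 'I_N -> 'M[K]_m -> K) :
  (forall i, regular_on G (F i)) -> regular_on G (fun g => p.@[F^~ g]).
Proof.
move=> FP; apply: (@regular_ext (fun g =>
  \sum_(u <- msupp p) p@_u * \prod_i F i g ^+ u i)) => [g _|].
  by rewrite mevalE.
apply: regular_sum => u; apply: regularM; first exact: regular_cst.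
by apply: regular_prod => i; apply: regularX.
Qed.

(** Entries of [invmx g] are cofactors over [\det g], and dividing by [\det (invmx g) ^+ e] is
    multiplying by [\det g ^+ e]. *)
Lemma regular_invmx phi : (forall g, G g -> G (invmx g)) ->
  regular_on G phi -> regular_on G (fun g => phi (invmx g)).
Proof.
move=> Ginv [p [e pE]].
apply: (@regular_ext (fun g => p.@[coord (invmx g)] * \det g ^+ e)) => [g Gg|].
  by rewrite pE; [rewrite det_inv exprVn invrK | exact: Ginv].
apply: regularM; last exact/regularX/regular_det.
apply: (@regular_meval _ p (fun k g => coord (invmx g) k)) => k.
case/mxvec_indexP: k => i j.
apply: regular_ext (regularM regular_invdet (regular_adj i j)) => g Gg.
by rewrite /coord /mxcoord [RHS]mxE mxvecE /invmx G_unit // [RHS]mxE.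
Qed.

End RegularFunctions.

(** * Linear substitutions, rational values and Zariski density *)

Section LinearSubstitution.
Variables (K : closedFieldType) (n : nat).
Implicit Types (p q : {mpoly K[n]}) (A : 'M[K]_n) (v : 'cV[K]_n).

Lemma pevalM p q v : peval (p * q) v = peval p v * peval q v.
Proof. exact: mevalM. Qed.

Lemma pevalZ c p v : peval (c *: p) v = c * peval p v.
Proof. exact: mevalZ. Qed.

Lemma peval_comp p A v : peval (pcomp_lin p A) v = peval p (A *m v).
Proof.
rewrite /peval /pcomp_lin comp_mpoly_meval; apply: meval_eq => i.
rewrite tnth_mktuple raddf_sum mxE; apply: eq_bigr => j _.
by rewrite /= mevalZ mevalXU.
Qed.

Lemma peval_inj p q : (forall v, peval p v = peval q v) -> p = q.
Proof.
move=> pq; apply/eqP; rewrite -subr_eq0; apply/negPn/negP.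
move=> /mpoly_nonzero[v /negP]; apply; rewrite mevalB subr_eq0.
have colE s : peval s (\col_i v i) = s.@[v].
  by apply: meval_eq => i; rewrite mxE.
by rewrite -!colE pq.
Qed.

Lemma dhomog_pcomp_lin p A d :
  p \is d.-homog -> pcomp_lin p A \is d.-homog.
Proof.
move=> /dhomogP pd; rewrite /pcomp_lin comp_mpolyEX big_seq.
apply: rpred_sum => u /pd /= <-; apply: rpredZ; rewrite comp_mpolyX mdegE.
elim/big_rec2: _ => [|i a q _ IH]; first exact: dhomog1.
apply: dhomogM => //; rewrite tnth_mktuple.
have linear_homog : \sum_(j < n) A i j *: 'X_j \is 1.-homog.
  by apply: rpred_sum => j _; apply: rpredZ; rewrite dhomogX /= mdeg1.
by have := dhomogMn (u i) linear_homog; rewrite mul1n.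
Qed.

(** Equal degrees of [p] and [s * p] leave degree zero for a nonzero [s]. This makes the quotient of
    D_g by [f] constant. *)
Lemma dhomog_quotient p s d :
  p != 0 -> p \is d.-homog -> s * p \is d.-homog -> s = (s@_0%MM)%:MP.
Proof.
move=> p0 pd spd; apply: msize1_polyC.
have [->|s0] := eqVneq s 0; first by rewrite msize0.
have := dhomog_uniq p0 (dhomog_msize pd) pd.
have sp0 : s * p != 0 by rewrite mulf_neq0.
have := dhomog_uniq sp0 (dhomog_msize spd) spd.
have sizeM : msize (s * p) = (msize s + msize p).-1%N := msizeM s0 p0.
rewrite /= sizeM.
have : (0 < msize p)%N by rewrite lt0n msize_poly_eq0.
lia.
Qed.

(** By cross-multiplication, any two fractions for [h] with denominators nonzero at [v] take the
    same value there. *)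
Lemma rational_value_frac p q v c : peval q v != 0 ->
  rational_value (p%:F / q%:F) v c <-> c = peval p v / peval q v.
Proof.
move=> qv; split=> [[p' [q' [q'v e ->]]]|->]; last by exists p, q.
have neq0 (s : {mpoly K[n]}) : peval s v != 0 ->
    s%:F != 0 :> {fraction {mpoly K[n]}}.
  by rewrite tofrac_eq0; apply: contraNneq => ->; rewrite /peval meval0.
move/eqP: e; rewrite eqr_div ?neq0 // -!tofracM tofrac_eq => /eqP e.
by apply/eqP; rewrite eqr_div // -!pevalM -e.
Qed.

Lemma rational_value_poly p v c : rational_value p%:F v c <-> c = peval p v.
Proof.
have one : peval (1 : {mpoly K[n]}) v = 1 by rewrite /peval meval1.
rewrite -[p%:F]divr1 -tofrac1 rational_value_frac one ?divr1 //.
exact: oner_neq0.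
Qed.

(** Some [s] vanishes off [U] but not at [v0]; then [s * p] and [s * q] agree everywhere, and [s]
    cancels. *)
Lemma zopen_dense (U : set 'cV[K]_n) v0 p q : zopen U -> U v0 ->
  (forall v, U v -> peval p v = peval q v) -> p = q.
Proof.
move=> [S US] Uv0 pq.
have [s [Ss sv0]] : exists s, S s /\ peval s v0 != 0.
  apply: contrapT => noS; suff : (~` U) v0 by [].
  rewrite US => s Ss; apply/eqP/negPn/negP => sv0; apply: noS.
  by exists s.
have s0 : s != 0 by apply: contraNneq sv0 => ->; rewrite /peval meval0.
apply: (mulfI s0); apply: peval_inj => v; rewrite !pevalM.
have [/pq ->//|nUv] := pselect (U v); have Zv : (~` U) v by [].
by move: Zv; rewrite US => /(_ _ Ss) ->; rewrite !mul0r.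
Qed.

End LinearSubstitution.

(** * Relative invariants of a prehomogeneous vector space *)

Section BasicInvariants.
Variables (K : closedFieldType) (m n : nat).
Variables (G : set 'M[K]_m) (rho : 'M[K]_m -> 'M[K]_n) (Omega : set 'cV[K]_n).
Hypothesis pvG : prehomogeneous G rho Omega.
Variables (r : nat) (fs : 'I_r -> {mpoly K[n]}) (chis : 'I_r -> 'M[K]_m -> K).
Hypothesis fs_basic : basic_relative_invariants Omega fs.
Hypothesis chisP : forall i, relative_invariant G rho Omega (fs i)%:F (chis i).
Variables (k : 'I_r -> nat) (f : {mpoly K[n]}) (chi : 'M[K]_m -> K).
Hypothesis fE : f = \prod_(i < r) fs i ^+ k i.
Hypothesis chiE : forall g, chi g = \prod_(i < r) chis i g ^+ k i.
Implicit Types (p q : {mpoly K[n]}) (g : 'M[K]_m) (v x : 'cV[K]_n).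

Let G_unit g : G g -> g \in unitmx := lag_unit (pv_group pvG) (g := g).
Let G_inv g : G g -> G (invmx g) := lag_inv (pv_group pvG) (g := g).

Lemma orbit_base : exists2 v0, Omega v0 & forall v, Omega v ->
  exists2 g, G g & v = rho g *m v0.
Proof.
have [v0 OmegaE] := pv_orbit pvG; have [_ rho1 _] := pv_rep pvG.
exists v0 => [|v]; rewrite OmegaE; last by case=> g Gg <-; exists g.
by exists 1%:M; [exact: lag_one (pv_group pvG) | rewrite rho1 mul1mx].
Qed.

Lemma orbit_stable g v : G g -> Omega v -> Omega (rho g *m v).
Proof.
move=> Gg; have [v0 ->] := pv_orbit pvG; have [_ _ rhoM] := pv_rep pvG.
move=> [g' Gg' <-]; exists (g *m g').
  exact: lag_mul (pv_group pvG) _ _ Gg Gg'.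
by rewrite rhoM // mulmxA.
Qed.

Lemma rhoK g v : G g -> rho g *m (rho (invmx g) *m v) = v.
Proof.
move=> Gg; have [_ rho1 rhoM] := pv_rep pvG.
have [gU Gg'] := (G_unit Gg, G_inv Gg).
by rewrite mulmxA -rhoM // mulmxV // rho1 mul1mx.
Qed.

Lemma chis_neq0 i g : G g -> chis i g != 0.
Proof. by case: (chisP i) => _ [_ + _] _; apply. Qed.

Lemma chi_neq0 g : G g -> chi g != 0.
Proof.
move=> Gg; rewrite chiE; apply/prodf_neq0 => i _.
by rewrite expf_neq0 // chis_neq0.
Qed.

Lemma chis_inv i g : G g -> chis i (invmx g) = (chis i g)^-1.
Proof.
move=> Gg; case: (chisP i) => _ [_ chi0 chiM] _.
have G1 : G 1%:M := lag_one (pv_group pvG).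
have chi1 : chis i 1%:M = 1.
  by apply: (mulfI (chi0 _ G1)); rewrite -chiM // mulmx1 mulr1.
apply: (mulfI (chi0 _ Gg)); rewrite -chiM ?mulmxV ?chi1 ?mulfV ?chi0 //.
- exact: G_unit.
- exact: G_inv.
Qed.

Lemma regular_chi_inv : regular_on G (fun g => (chi g)^-1).
Proof.
have reg_i i : regular_on G (fun g => chis i (invmx g) ^+ k i).
  by apply: regularX; apply: regular_invmx => //; case: (chisP i) => _ [].
apply: regular_ext (regular_prod (index_enum _) reg_i) => g Gg.
by rewrite chiE -prodfV; apply: eq_bigr => i _; rewrite chis_inv // exprVn.
Qed.

Lemma fs_neq0_orbit i v : Omega v -> peval (fs i) v != 0.
Proof.
move=> Ov; have [_ _ /(_ (zero_set (fs i)))[_ fsP]] := fs_basic.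
have [[_ sub _] _] := fsP (ex_intro _ i erefl).
by apply/negP => /eqP /(sub v); apply.
Qed.

Lemma f_neq0_orbit v : Omega v -> peval f v != 0.
Proof.
move=> Ov; rewrite fE /peval rmorph_prod; apply/prodf_neq0 => i _.
by rewrite rmorphXn expf_neq0 //; exact: fs_neq0_orbit.
Qed.

Lemma f_neq0 : f != 0.
Proof.
have [v0 Ov0 _] := orbit_base.
by apply: contraNneq (f_neq0_orbit Ov0) => ->; rewrite /peval meval0.
Qed.

Lemma fs_prime i : prime_elt (fs i).
Proof.
have [fs_irr _ _] := fs_basic.
by apply: irreducible_prime (fs_irr i); apply: factorial_mpoly.
Qed.

(** Irreducible polynomials, one dividing the other, are associated and share their zero set, but
    the [fs i] have distinct zero sets. *)
Lemma fs_rdvd_inj i j : rdvd (fs i) (fs j) -> i = j.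
Proof.
have [fs_irr fs_inj _] := fs_basic.
move=> /(rdvd_irreducible (fs_irr i) (fs_irr j))[u uU e].
apply: fs_inj; rewrite /zero_set e; apply/seteqP; split=> v /=; rewrite pevalM.
  by move=> ->; rewrite mulr0.
move/eqP; rewrite mulf_eq0 => /orP[/eqP u0|/eqP //].
have := rmorph_unit (meval (fun i => v i ord0)) uU.
by rewrite /= -/(peval u v) u0 unitr0.
Qed.

Lemma fs_rdvd_f i : rdvd (fs i ^+ k i) f.
Proof. by rewrite fE (bigD1 i) //=; apply: rdvdMr; exists 1; rewrite mul1r. Qed.

Lemma f_rdvd p : (forall i, (0 < k i)%N -> rdvd (fs i ^+ k i) p) -> rdvd f p.
Proof.
move=> fsp; rewrite fE; apply: coprime_powers_rdvd.
- exact: index_enum_uniq.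
- exact: fs_prime.
- exact: fs_rdvd_inj.
- move=> i; have [|/fsp //] := posnP (k i).
  by move=> ->; exists p; rewrite expr0 mulr1.
Qed.

(** Relative invariance is given on the orbit only; density makes it a polynomial identity. *)
Lemma pcomp_f g : G g -> pcomp_lin f (rho g) = chi g *: f.
Proof.
move=> Gg; have [v0 Ov0 _] := orbit_base.
apply: (zopen_dense (pv_open pvG) Ov0) => v Ov; rewrite peval_comp fE chiE.
rewrite pevalZ /peval !rmorph_prod -big_split; apply: eq_bigr => i _ /=.
rewrite !rmorphXn -exprMn; congr (_ ^+ _).
case: (chisP i) => _ _ /(_ g v Gg Ov)[a [b []]].
by move=> /rational_value_poly -> /rational_value_poly ->.
Qed.

Lemma peval_f g v : G g -> peval f (rho g *m v) = chi g * peval f v.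
Proof. by move=> Gg; rewrite -peval_comp pcomp_f // pevalZ. Qed.

(** * Additive invariance, divisibility by [f] and level sets *)

Variables (d : nat) (h1 : {mpoly K[n]}).
Hypotheses (h1_homog : h1 \is d.-homog) (f_homog : f \is d.-homog).

(** The polynomial D_g: how far [h1] is from being a relative invariant for [chi]. *)
Let defect g := pcomp_lin h1 (rho g) - chi g *: h1.

Lemma peval_defect g v :
  peval (defect g) v = peval h1 (rho g *m v) - chi g * peval h1 v.
Proof. by rewrite -pevalZ -peval_comp [LHS]mevalB. Qed.

Lemma additive_rdvd :
  additive_relative_invariant G rho Omega (h1%:F / f%:F) ->
  forall g, G g -> rdvd f (defect g).
Proof.
move=> [Phi _ hP] g Gg; have [v0 Ov0 _] := orbit_base.
exists (Phi g * chi g)%:MP; rewrite mul_mpolyC.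
apply: (zopen_dense (pv_open pvG) Ov0) => v Ov.
have [a [b []]] := hP g v Gg Ov.
have fv := f_neq0_orbit Ov; have fgv := f_neq0_orbit (orbit_stable Gg Ov).
move=> /(rational_value_frac _ _ fgv) -> /(rational_value_frac _ _ fv) -> <-.
rewrite peval_defect peval_f // pevalZ.
have := chi_neq0 Gg; move: (chi g) (peval h1 _) (peval h1 _) => c s t c0.
by field; rewrite fv c0.
Qed.

Lemma rdvd_additive :
  (forall g, G g -> rdvd f (defect g)) ->
  additive_relative_invariant G rho Omega (h1%:F / f%:F).
Proof.
move=> fD; have [v0 Ov0 _] := orbit_base.
pose H v := peval h1 v / peval f v.
pose Phi g := H (rho g *m v0) - H v0.
(* [Phi] is defined at the base point [v0]; its independence of that point yields additivity. *)
have PhiP g v : G g -> Omega v -> H (rho g *m v) - H v = Phi g.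
  move=> Gg; have [s De] := fD g Gg.
  have [c s_eq] : exists c, s = c%:MP.
    exists s@_0%MM; apply: (dhomog_quotient f_neq0 f_homog); rewrite -De.
    by apply: rpredB; [exact: dhomog_pcomp_lin | exact: rpredZ].
  suff HE w : Omega w -> H (rho g *m w) - H w = c / chi g.
    by move=> Ov; rewrite HE // -(HE v0).
  move=> Ow; have fw := f_neq0_orbit Ow; have c0 := chi_neq0 Gg.
  have := peval_defect g w.
  rewrite De s_eq mul_mpolyC pevalZ => /esym/eqP.
  rewrite subr_eq /H peval_f // => /eqP ->.
  by field; rewrite fw c0.
exists Phi => [|g v Gg Ov].
  split=> [|g g' Gg Gg'].
    (* Up to a constant, [Phi g] is h1(rho(g) v0) / (chi(g) f(v0)), a product of regular functions
       of [g]. *)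
    have reg_h1 : regular_on G (fun g => peval h1 (rho g *m v0)).
      apply: (@regular_meval _ _ _ G_unit _ h1
        (fun i g => (rho g *m v0) i ord0)) => i.
      have [reg_rho _ _] := pv_rep pvG.
      have reg_ij j : regular_on G (fun g => rho g i j * v0 j ord0).
        by apply: regularM => //; apply: regular_cst.
      apply: regular_ext (regular_sum G_unit (index_enum _) reg_ij) => g _.
      by rewrite mxE.
    have reg_H := regularM (regularM reg_h1 regular_chi_inv)
                           (regular_cst G (peval f v0)^-1).
    apply: regular_ext (regularD G_unit reg_H (regular_cst G (- H v0))) => g Gg.
    by rewrite /Phi {2}/H peval_f // invfM mulrA.
  have [_ _ rhoM] := pv_rep pvG.
  (* The difference telescopes through the orbit point [rho g' *m v0]. *)
  rewrite {1}/Phi rhoM // -mulmxA -(PhiP g (rho g' *m v0)) //.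
    by rewrite /Phi addrA subrK.
  exact: orbit_stable.
exists (H (rho g *m v)), (H v); split.
- by apply/rational_value_frac=> //; apply: f_neq0_orbit; apply: orbit_stable.
- by apply/rational_value_frac=> //; apply: f_neq0_orbit.
- exact: PhiP.
Qed.

Lemma level_set_sub g eps x : G g -> rdvd f (defect g) ->
  level_set f h1 eps x -> level_set f h1 (chi g * eps) (rho g *m x).
Proof.
move=> Gg [s De] [fx /eqP]; rewrite subr_eq0 => /eqP hx; split.
  by rewrite peval_f // fx mulr0.
by rewrite -hx -peval_defect De pevalM fx mulr0.
Qed.

Lemma rdvd_level_set g eps : (forall g', G g' -> rdvd f (defect g')) -> G g ->
  [set rho g *m x | x in level_set f h1 eps] = level_set f h1 (chi g * eps).
Proof.
move=> fD Gg; apply/seteqP; split=> [_ [x xL <-]|y yL].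
  exact: level_set_sub (fD g Gg) xL.
(* The reverse inclusion is the forward one for [invmx g]. *)
have Gg' := G_inv Gg.
exists (rho (invmx g) *m y); last exact: rhoK.
have -> : eps = chi (invmx g) * (chi g * eps).
  2: exact: level_set_sub (fD _ _) yL.
rewrite mulrA (_ : chi (invmx g) = (chi g)^-1) ?mulVf ?mul1r ?chi_neq0 //.
by rewrite !chiE -prodfV; apply: eq_bigr => i _; rewrite chis_inv // exprVn.
Qed.

Lemma level_set_rdvd : preduced f ->
  (forall g eps, G g ->
     [set rho g *m x | x in level_set f h1 eps]
       = level_set f h1 (chi g * eps)) ->
  forall g, G g -> rdvd f (defect g).
Proof.
move=> f_red fL g Gg; apply: f_rdvd => i ki.
have [_ fsU _] := fs_prime i.
(* A larger exponent would make the square of [fs i] divide the reduced [f]. *)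
have -> : k i = 1%N.
  apply/eqP; rewrite eqn_leq ki andbT leqNgt; apply/negP => ki2.
  case/negP: fsU; apply: f_red; apply: rdvd_trans (fs_rdvd_f i).
  by exists (fs i ^+ (k i - 2)); rewrite -exprD subnK.
rewrite expr1; apply: prime_vanishing (fs_prime i) _ => v fsv.
pose x : 'cV[K]_n := \col_j v j.
have xE p : peval p x = p.@[v] by apply: meval_eq => j; rewrite mxE.
have fx : peval f x = 0.
  have [s ->] := fs_rdvd_f i.
  by rewrite xE mevalM rmorphXn /= fsv expr0n gtn_eqF ?mulr0.
(* A zero [x] of [f] lies on the level set for [eps = peval h1 x]; the level of its image says that
   D_g vanishes at [x]. *)
have [] : level_set f h1 (chi g * peval h1 x) (rho g *m x).
  by rewrite -fL //; exists x => //; split=> //; rewrite subrr.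
by rewrite -xE peval_defect.
Qed.

End BasicInvariants.

(** * The equivalences over the complex numbers *)

Local Open Scope complex_scope.

Theorem proposition3p8 (R : realType) (m n : nat)
  (G : set 'M[R[i]]_m) (rho : 'M[R[i]]_m -> 'M[R[i]]_n)
  (Omega : set 'cV[R[i]]_n)
  (pvG : prehomogeneous G rho Omega)
  (r : nat) (fs : 'I_r -> {mpoly R[i][n]}) (chis : 'I_r -> 'M[R[i]]_m -> R[i])
  (fs_basic : basic_relative_invariants Omega fs)
  (chisP : forall i, relative_invariant G rho Omega (fs i)%:F (chis i))
  (k : 'I_r -> nat) (d : nat) (h1 f : {mpoly R[i][n]})
  (h : {fraction {mpoly R[i][n]}}) (chi : 'M[R[i]]_m -> R[i])
  (fE : f = \prod_(i < r) fs i ^+ k i)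
  (h1_homog : h1 \is d.-homog) (f_homog : f \is d.-homog)
  (hE : h = h1%:F / f%:F) (h1f_coprime : pcoprime h1 f)
  (chiE : forall g, chi g = \prod_(i < r) chis i g ^+ k i) :
  [/\ additive_relative_invariant G rho Omega h <->
      (forall i, (0 < k i)%N -> forall g, G g ->
         agree_to_order (k i).-1 (fs i) (pcomp_lin h1 (rho g)) (chi g *: h1)),
      (forall i, (0 < k i)%N -> forall g, G g ->
         agree_to_order (k i).-1 (fs i) (pcomp_lin h1 (rho g)) (chi g *: h1)) <->
      (forall g, G g -> pdvd f (pcomp_lin h1 (rho g) - chi g *: h1)) &
      preduced f ->
        (additive_relative_invariant G rho Omega h <->
         forall g (eps : R[i]), G g ->
           [set rho g *m x | x in level_set f h1 eps]
             = level_set f h1 (chi g * eps))].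
Proof.
(* Agreement to order [(k i).-1] is divisibility by [fs i ^+ (k i).-1.+1], which is [fs i ^+ k i]
   because [k i] is positive. *)
have div_agree : (forall i, (0 < k i)%N -> forall g, G g ->
    agree_to_order (k i).-1 (fs i) (pcomp_lin h1 (rho g)) (chi g *: h1)) <->
    (forall g, G g -> pdvd f (pcomp_lin h1 (rho g) - chi g *: h1)).
  split=> [agree g Gg|fD i ki g Gg].
    apply: (f_rdvd fs_basic fE) => i ki.
    by have := agree i ki g Gg; rewrite /agree_to_order prednK.
  rewrite /agree_to_order prednK //.
  exact: rdvd_trans (fs_rdvd_f fE i) (fD g Gg).
have additive_div : additive_relative_invariant G rho Omega h <->
    (forall g, G g -> pdvd f (pcomp_lin h1 (rho g) - chi g *: h1)).
  rewrite hE; split.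
    exact: (additive_rdvd pvG fs_basic chisP fE chiE).
  exact: (rdvd_additive pvG fs_basic chisP fE chiE h1_homog f_homog).
split=> //; first by rewrite additive_div div_agree.
move=> f_red; rewrite additive_div; split.
  by move=> fD g eps; apply: (rdvd_level_set pvG chisP fE chiE).
exact: (level_set_rdvd fs_basic fE).
Qed.
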